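(* Let $N\ge1$ and let $\boldsymbol\sigma=(\sigma_1,\dots,\sigma_{2N})\in\{-1,+1\}^{2N}$ with $\sum_i\sigma_i=0$. Let $J$ be any generic instance with $N$ white and $N$ black points in a segment $[0,L]$ whose sign vector is $\boldsymbol\sigma(J)=\boldsymbol\sigma$. Then the number $Z(\boldsymbol\sigma)$ of optimal matchings of $J$ is $$Z(\boldsymbol\sigma)=\prod_{\substack{i=1,\dots,2N\\ h_i\sigma_i<0}}\bar h_i(\boldsymbol\sigma),$$ where $h_i=h_i(\boldsymbol\sigma)=\sigma_1+\dots+\sigma_{i-1}+\tfrac{\sigma_i}{2}$ and $\bar h_i(\boldsymbol\sigma)=|h_i(\boldsymbol\sigma)|+\tfrac12$.
   Context: An instance $J=(W,B)$ consists of $N$ white points $W=\{w_1<\dots<w_N\}$ and $N$ black points $B=\{b_1<\dots<b_N\}$ in a segment $[0,L]$; it is generic if no two of the $2N$ coordinates are equal. Let $p_1<p_2<\dots<p_{2N}$ be the points of $W\cup B$ in increasing order. The sign vector $\boldsymbol\sigma(J)\in\{-1,+1\}^{2N}$ has $\sigma_i=+1$ if $p_i$ is white and $\sigma_i=-1$ if $p_i$ is black. A matching is a permutation $\pi\in\mathfrak S_N$ (linking $w_i$ to $b_{\pi(i)}$), with cost $H_J(\pi)=\sum_{i=1}^N|w_i-b_{\pi(i)}|$. An optimal matching is a minimizer of $H_J$ over $\mathfrak S_N$; $\mathcal Z_J$ is the set of optimal matchings and $Z_J=|\mathcal Z_J|$. Since $Z_J$ depends on $J$ only through $\boldsymbol\sigma(J)$,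 one writes $Z(\boldsymbol\sigma)=Z_J$ for any $J$ with $\boldsymbol\sigma(J)=\boldsymbol\sigma$. *)

(* Defs.v *)
From mathcomp Require Import all_boot all_order all_algebra all_fingroup.

Set Implicit Arguments.
Unset Strict Implicit.
Unset Printing Implicit Defensive.

Import Order.TTheory GRing.Theory Num.Theory.
Local Open Scope ring_scope.

Record instance (R : realFieldType) (N : nat) (L : R) := Instance {
  white : 'I_N -> R;
  black : 'I_N -> R;
  white_incr : forall i j : 'I_N, (i < j)%N -> white i < white j;
  black_incr : forall i j : 'I_N, (i < j)%N -> black i < black j;
  white_seg : forall i : 'I_N, 0 <= white i <= L;
  black_seg : forall i : 'I_N, 0 <= black i <= L
}.

Section Matchings.
Context {R : realFieldType} {N : nat} {L : R}.
Implicit Types (J : instance N L) (pi : 'S_N).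

Definition points J : seq R := codom (white J) ++ codom (black J).

Definition generic J : Prop := uniq (points J).

Definition sorted_points J : seq R := sort <=%R (points J).

(* The default 0 of nth is never reached: sorted_points J has size 2N. *)
Definition sign_vector J : {ffun 'I_(2 * N) -> int} :=
  [ffun i : 'I_(2 * N) =>
     if nth 0 (sorted_points J) i \in codom (white J) then 1 else -1].

Definition cost J pi : R := \sum_(i < N) `|white J i - black J (pi i)|.

Definition optimal_matchings J : {set 'S_N} :=
  [set pi : 'S_N | [forall pi' : 'S_N, cost J pi <= cost J pi']].

Definition num_optimal J : nat := #|optimal_matchings J|.

End Matchings.

Section Heights.
Context {n : nat}.
Implicit Types (sigma : {ffun 'I_n -> int}) (i : 'I_n).

Definition height sigma i : rat :=
  (\sum_(j < n | (j < i)%N) (sigma j)%:~R) + (sigma i)%:~R / 2%:R.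

Definition bar_height sigma i : rat := `|height sigma i| + 1 / 2%:R.

End Heights.

(* Main.v *)
Require Import Defs.
From mathcomp Require Import all_boot all_order all_algebra all_fingroup.
From mathcomp Require Import zify ring lra.

Set Implicit Arguments.
Unset Strict Implicit.
Unset Printing Implicit Defensive.

Import Order.TTheory GRing.Theory Num.Theory.
Local Open Scope ring_scope.

(* Read from left to right, a point either opens an edge or closes one.  In an
   optimal matching no gap is crossed by two edges of opposite directions, so
   before each point the open edges all have the same colour and their number is
   the absolute value of the partial sum of signs; a point of the opposite colour
   must then close one of them, and any choice is allowed.  Conversely, in a
   matching with that property the sign vector decides which points open and
   which close, so all such matchings have the same cost, and uncrossing two
   opposite overlapping edges shows that only they can be minimal. *)

(** * Counting recursion along a sign sequence *)

Fixpoint choices (s : int) (v : seq int) : nat :=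
  if v is e :: v' then ((if (s * e < 0)%R then `|s|%N else 1) * choices (s + e) v')%N
  else 1.

(** In [choices s v] the state [s] is the signed number of open edges, and a sign opposite to it
    picks which of them to close. Before position [i] the state is [s] plus the signs already
    read. *)
Lemma choicesE s v :
  choices s v = (\prod_(i < size v)
    (let S := (s + \sum_(j < i) v`_j)%R in
     if (S * v`_i < 0)%R then `|S|%N else 1))%N.
Proof.
elim: v s => [|e v IHv] s /=; first by rewrite big_ord0.
rewrite big_ord_recl /= big_ord0 addr0 IHv; congr (_ * _)%N.
apply: eq_bigr => i _; rewrite /= /bump /= add1n.
by rewrite big_ord_recl /= addrA.
Qed.

(** The right side adds the lengths of the segments [[a,d]] and [[c,b]], which overlap. The left
    side joins left end to left end and right end to right end, saving twice the length of the
    overlap. *)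
Lemma norm_uncross (R : realFieldType) (a b c d : R) :
  a < d -> c < b -> a < b -> c < d ->
  `|a - c| + `|b - d| < `|a - d| + `|b - c|.
Proof.
move=> ad cb ab cd.
rewrite (ltr0_norm (x := a - d)) ?subr_lt0 //.
rewrite (gtr0_norm (x := b - c)) ?subr_gt0 //.
have absE (x y : R) : (y <= x /\ `|x - y| = x - y) \/ (x <= y /\ `|x - y| = y - x).
  case: (leP y x) => h; [left|right].
    by rewrite ger0_norm ?subr_ge0.
  by rewrite ltr0_norm ?subr_lt0 // opprB (ltW h).
by case: (absE a c) => -[? ->]; case: (absE b d) => -[? ->]; lra.
Qed.

(** * Matchings as involutions on coloured points *)

Section Mates.
Context {I : finType}.
Implicit Types (pi : {perm I}) (t x y : I + I).

(** Whites ([inl]) and blacks ([inr]) are put in one type so that a single argument serves both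
    colours. *)
Definition mate pi t : I + I :=
  match t with inl i => inr (pi i) | inr j => inl ((pi^-1)%g j) end.

Definition sg t : int := if t is inl _ then 1 else -1.

Lemma mateK pi : involutive (mate pi).
Proof. by case=> i /=; rewrite ?permK ?permKV. Qed.

Lemma sg_mate pi t : sg (mate pi t) = - sg t.
Proof. by case: t => i //=; rewrite opprK. Qed.

Lemma mate_inj pi pi' : mate pi =1 mate pi' -> pi = pi'.
Proof. by move=> e; apply/permP => i; case: (e (inl i)). Qed.

Lemma mate_link pi i j t :
  let pi' := (pi * tperm (pi i) j)%g in
  t != inl i -> t != inr j -> mate pi t != inl i -> mate pi t != inr j ->
  mate pi' t = mate pi t.
Proof.
move=> pi'; case: t => k /= ti tj mi mj.
  rewrite permM tpermD //; first by rewrite (inj_eq perm_inj) eq_sym.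
  by apply: contraNneq mj => ->.
congr inl; rewrite invMg permM tpermV tpermD //.
  by apply: contraNneq mi => <-; rewrite permK.
by apply: contraNneq tj => ->.
Qed.

(** Supplies the new base matching when the pair [x], [y] is removed: one transposition affects only
    [x], [y] and their former partners. *)
Lemma mate_swap pi x y : sg x != sg y ->
  exists pi', mate pi' x = y /\
    forall t, t != x -> t != y -> mate pi t != x -> mate pi t != y ->
      mate pi' t = mate pi t.
Proof.
case: x => i; case: y => j // _.
  exists (pi * tperm (pi i) j)%g; split; last exact: mate_link.
  by rewrite /= permM tpermL.
exists (pi * tperm (pi j) i)%g; split; last first.
  by move=> t h1 h2 h3 h4; apply: mate_link.
by rewrite /= invMg permM tpermV tpermR permK.
Qed.

(** * Consistent matchings and their number *)

Section Consistent.
Context {disp : Order.disp_t} {R : porderType disp} (pos : I + I -> R).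

(** Here [x] and [y] are left ends, so their colours give the directions of their edges; the last
    two inequalities say that these edges overlap. *)
Definition consistent pi (D : {set I + I}) :=
  [forall x in D, forall y in D, (sg x != sg y) ==>
    ~~ [&& (pos x < pos (mate pi x))%O, (pos y < pos (mate pi y))%O,
           (pos x < pos (mate pi y))%O & (pos y < pos (mate pi x))%O]].

Lemma consistentP pi (D : {set I + I}) :
  reflect (forall x y, x \in D -> y \in D -> sg x != sg y ->
     (pos x < pos (mate pi x))%O -> (pos y < pos (mate pi y))%O ->
     (pos x < pos (mate pi y))%O -> (pos y < pos (mate pi x))%O -> False)
   (consistent pi D).
Proof.
apply: (iffP idP) => [/forall_inP h x y xD yD n h1 h2 h3 h4|h].
  move: (h x xD) => /forall_inP/(_ y yD)/implyP/(_ n).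
  by rewrite h1 h2 h3 h4.
apply/forall_inP => x xD; apply/forall_inP => y yD; apply/implyP => n.
by apply/negP => /and4P[*]; apply: (h x y).
Qed.

(* Pinning matchings to [pi0] outside [D] lets the induction that removes matched
   pairs stay inside one group of permutations. *)
Definition completions pi0 (D : {set I + I}) : {set {perm I}} :=
  [set pi | [forall t in ~: D, mate pi t == mate pi0 t] & consistent pi D].

Lemma completionsP pi0 (D : {set I + I}) pi :
  reflect ((forall t, t \notin D -> mate pi t = mate pi0 t) /\ consistent pi D)
    (pi \in completions pi0 D).
Proof.
rewrite inE; apply: (iffP andP) => -[h ?]; split => //.
  by move=> t tD; apply/eqP; apply: (forall_inP h); rewrite inE.
by apply/forall_inP => t; rewrite inE => /h ->.
Qed.

(** A conflict with the edge from [p] to [q] would need a left end in [D], before [q] and of the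
    colour opposite to [p]; the last hypothesis excludes it. So removing the pair loses no
    constraint. *)
Lemma completions_link pi0 pi1 p q (D : {set I + I}) :
  p \in D -> q \in D ->
  (forall t, t \notin D -> mate pi0 t \notin D) ->
  mate pi1 p = q ->
  (forall t, t != p -> t != q -> mate pi0 t != p -> mate pi0 t != q ->
      mate pi1 t = mate pi0 t) ->
  (pos p < pos q)%O ->
  (forall x, x \in D -> sg x != sg p -> ~~ (pos x < pos q)%O) ->
  [set pi in completions pi0 D | mate pi q == p] =
  completions pi1 (D :\: [set p; q]).
Proof.
move=> pD qD cl m1 sw pq first.
have out t : t \notin D -> mate pi1 t = mate pi0 t.
  move=> tD; have mD := cl t tD.
  by apply: sw; apply/eqP => e; move: tD mD; rewrite ?e ?pD ?qD // -e.
have m1q : mate pi1 q = p by rewrite -m1 mateK.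
apply/setP => pi; rewrite inE; apply/andP/completionsP.
  move=> [/completionsP[h /consistentP c] /eqP mq]; split.
    move=> t; rewrite !inE negb_and negbK => /orP[/orP[]/eqP->|tD].
    - by rewrite m1 -mq mateK.
    - by rewrite m1q.
    by rewrite h // out.
  apply/consistentP => x y; rewrite !inE => /andP[_ xD] /andP[_ yD].
  exact: c.
move=> [h /consistentP c].
have mq : mate pi q = p by rewrite h ?m1q // !inE eqxx orbT.
have mp : mate pi p = q by rewrite -mq mateK.
split; last exact/eqP.
apply/completionsP; split.
  by move=> t tD; rewrite h ?out // !inE (negbTE tD) andbF.
have noq : ~ (pos q < pos (mate pi q))%O.
  by rewrite mq => qp; move: (lt_trans pq qp); rewrite ltxx.
apply/consistentP => x y xD yD n h1 h2 h3 h4.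
have [ex|xp] := eqVneq x p.
  move: h4; rewrite ex mp => h4.
  by have := first y yD; rewrite -ex eq_sym n h4 => /(_ isT).
have [ex|xq] := eqVneq x q; first by subst x; apply: noq.
have [ey|yp] := eqVneq y p.
  move: h3; rewrite ey mp => h3.
  by have := first x xD; rewrite -ey n h3 => /(_ isT).
have [ey|yq] := eqVneq y q; first by subst y; apply: noq.
by apply: (c x y) => //; rewrite !inE negb_or ?xp ?xq ?yp ?yq.
Qed.

(* [P] is the set of points already read whose edge is still open, [u] the list
   of points still to be read. *)
Lemma card_completions (u : seq (I + I)) (P : {set I + I}) (c : int) pi0 :
  let D := P :|: [set x in u] in
  (forall x, x \in P -> sg x = c) ->
  c = 1 \/ c = -1 ->
  pairwise (relpre pos <%O) u ->
  (forall x y, x \in P -> y \in u -> pos x < pos y)%O ->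
  (forall t, t \notin D -> mate pi0 t \notin D) ->
  #|completions pi0 D| = choices (c *+ #|P|) (map sg u).
Proof.
elim: u P c pi0 => [|q u IHu] P c pi0 D sgP c1 srt Pu cl.
  (* With nothing left to read, [P] is closed under [mate pi0] but has a single colour, hence is
     empty. *)
  have DE : D = set0.
    apply/setP => x; rewrite !inE orbF; apply/negP => xP.
    have mP : mate pi0 x \in P.
      apply: contraLR (xP) => mP.
      by have := cl (mate pi0 x); rewrite mateK !inE !orbF => /(_ mP).
    have := sgP _ mP; rewrite sg_mate (sgP _ xP).
    by case: c1 => ->.
  rewrite /= (_ : completions _ _ = [set pi0]) ?cards1 //.
  apply/setP => pi; rewrite in_set1; apply/completionsP/eqP => [[h _]|->].
    by apply: mate_inj => t; apply: h; rewrite DE inE.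
  by split=> //; apply/consistentP => x y; rewrite DE inE.
move: srt => /= /andP[/allP qu srt].
have qP : q \notin P.
  by apply/negP => qP; have := Pu _ _ qP (mem_head q u); rewrite ltxx.
have qu' : q \notin u by apply/negP => /qu /=; rewrite ltxx.
have sg1 (t : I + I) : sg t = 1 \/ sg t = -1 by case: t; [left|right].
(* In this case [q] opens an edge: it joins the open points, [D] is unchanged and the factor is
   1. *)
have [cq|] := boolP ((#|P| == 0)%N || (sg q == c)).
  have -> : D = (q |: P) :|: [set x in u].
    by apply/setP => x; rewrite !inE orbA (orbC (x \in P)).
  have PE : c *+ #|P| = sg q *+ #|P|.
    by move/orP: cq => [] /eqP->; rewrite ?mulr0n.
  have ge0 : (sg q *+ #|P| * sg q < 0) = false.
    by rewrite mulrnAl; case: (sg1 q) => ->; rewrite ?mulrNN mulr1; lia.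
  rewrite PE ge0 mul1n (IHu _ (sg q)) //.
  - by rewrite cardsU1 qP add1n mulrS addrC.
  - move=> x /setU1P[->//|xP]; move/orP: cq => [/eqP/cards0_eq P0|/eqP->].
      by move: xP; rewrite P0 inE.
    exact: sgP.
  - move=> x y /setU1P[->|xP] yu; first exact: qu.
    by apply: Pu; rewrite // inE yu orbT.
  move=> t; have := cl t; rewrite !inE.
  by rewrite -!orbA (orbCA (t == q)) (orbCA (_ == q)).
rewrite negb_or => /andP[P0 qc].
have qD : q \in D by rewrite !inE eqxx orbT.
have far x : x \in D -> sg x != c -> (x == q) || (pos q < pos x)%O.
  rewrite !inE => /or3P[/sgP->|->//|/qu /= ->]; first by rewrite eqxx.
  by rewrite orbT.
have qE : sg q = - c by case: (sg1 q) qc => ->; case: c1 => ->.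
(* Otherwise [q] would be a left end, while the edge of any [p] in [P] passes over [q] in the
   opposite direction. *)
have matePq pi : pi \in completions pi0 D -> mate pi q \in P.
  move=> /completionsP[h /consistentP cons].
  have Dm x : x \in D -> mate pi x \in D.
    apply: contraLR => mD; have := cl _ mD.
    by rewrite -(h _ mD) mateK.
  apply/negPn/negP => mP.
  have qm : (pos q < pos (mate pi q))%O.
    have := Dm q qD; rewrite !inE (negbTE mP) /= => /orP[/eqP e|/qu //].
    by have := sg_mate pi q; rewrite e; case: (sg1 q) => ->.
  have /card_gt0P[p pP] : (0 < #|P|)%N by rewrite lt0n.
  have pq := Pu p q pP (mem_head _ _).
  have pD : p \in D by rewrite !inE pP.
  have qmp : (pos q < pos (mate pi p))%O.
    have npm : sg (mate pi p) != c.
      by rewrite sg_mate (sgP p pP); case: c1 => ->.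
    have /orP[/eqP e|//] := far _ (Dm p pD) npm.
    by move: mP; rewrite -e mateK pP.
  apply: (cons p q) => //; first by rewrite (sgP p pP) eq_sym.
    exact: lt_trans qmp.
  exact: lt_trans qm.
have lt0 : (c *+ #|P| * sg q < 0).
  rewrite qE mulrnAl; case: c1 => ->; rewrite ?mulrNN ?mulrN mulr1; lia.
(* Split by the partner [p] of [q]. Each class is a completion problem without [p] and [q], with the
   same count for every [p], whence the factor [#|P|]. *)
rewrite lt0 -sum1_card (partition_big (fun pi => mate pi q) (mem P)) //=.
have -> : (`|c *+ #|P| |%N = #|P|) by case: c1 => ->; lia.
rewrite -sum_nat_const; apply: eq_bigr => p pP.
have pD : p \in D by rewrite !inE pP.
have pq := Pu p q pP (mem_head _ _).
have npq : sg p != sg q by rewrite (sgP p pP) eq_sym.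
have [pi1 [m1 sw]] := mate_swap pi0 npq.
have setE := completions_link pD qD cl m1 sw pq _.
transitivity #|[set pi in completions pi0 D | mate pi q == p]|.
  by rewrite -sum1_card; apply: eq_bigl => pi; rewrite !inE.
rewrite setE; last first.
  move=> x xD; rewrite (sgP p pP) => /(far x xD) /orP[/eqP->|qx].
    by rewrite ltxx.
  by apply/negP => xq; have := lt_trans qx xq; rewrite ltxx.
have DE : D :\: [set p; q] = (P :\ p) :|: [set x in u].
  apply/setP => x; rewrite !inE.
  have [->|xp] := eqVneq x p.
    rewrite /=; apply/esym/negP => pu; have := Pu p p pP.
    by rewrite inE pu orbT ltxx => /(_ isT).
  by have [->|xq] := eqVneq x q; rewrite /= ?(negbTE qP) ?(negbTE qu').
rewrite DE (IHu _ c) //.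
- by congr choices; rewrite (cardsD1 p P) pP add1n mulrS qE addrAC subrr add0r.
- by move=> x /setD1P[_ /sgP].
- by move=> x y /setD1P[_ xP] yu; apply: Pu; rewrite // inE yu orbT.
rewrite -DE => t; rewrite !in_setD !in_set2 negb_and negbK.
have m1q : mate pi1 q = p by rewrite -m1 mateK.
move=> /orP[/orP[]/eqP->|tD]; rewrite ?m1 ?m1q ?eqxx ?orbT //.
have mD := cl t tD.
rewrite sw ?(negbTE mD) ?andbF //;
  by apply/eqP => e; move: tD mD; rewrite ?e ?pD ?qD // -e.
Qed.

End Consistent.

(** * Cost and optimality *)

Section Cost.
Context {R : realFieldType} (pos : I + I -> R).
Hypothesis pos_inj : injective pos.

(* Depends on the points only, not on the matching. *)
Definition closing t : bool := (\sum_(x | (pos x < pos t)%R) sg x) * sg t < 0.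

Definition mcost pi : R := \sum_i `|pos (inl i) - pos (inr (pi i))|.

(** Only edges reaching [t] from the left survive in the sum. If [t] is a right end, their left ends
    share the colour of its mate, which is one of them, so the product is negative; if [t] is a left
    end, they share its own colour. *)
Lemma closingE pi t : consistent pos pi setT ->
  closing t = (pos (mate pi t) < pos t).
Proof.
move=> /consistentP cons0.
have cons x y := cons0 x y (in_setT x) (in_setT y).
pose cross x := (pos x < pos t) && (pos t <= pos (mate pi x)).
have sumE : \sum_(x | pos x < pos t) sg x = \sum_(x | cross x) sg x.
  rewrite (bigID (fun x => pos (mate pi x) < pos t)) /=.
  set A := (X in X + _ = _).
  (* Matched pairs lying entirely to the left of [t] cancel out. *)
  have AN : A = - A.
    rewrite {1}/A (reindex_inj (inv_inj (mateK pi))) -sumrN.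
    apply: eq_big => x; first by rewrite mateK andbC.
    by rewrite sg_mate.
  have -> : A = 0 by lia.
  by rewrite add0r; apply: eq_bigl => x; rewrite -leNgt.
have sgM x : sg x * sg x = 1 by case: x.
rewrite /closing sumE mulr_suml.
have [mt|tm] := ltP (pos (mate pi t)) (pos t).
  have cE x : cross x -> sg x * sg t = -1.
    move=> /andP[xt tx]; suff : ~~ (sg x != sg (mate pi t)).
      by rewrite negbK sg_mate => /eqP->; rewrite mulNr sgM.
    by apply/negP => n; apply: (cons x (mate pi t)); rewrite ?mateK //;
      [apply: lt_le_trans tx | apply: lt_le_trans tx].
  rewrite (eq_bigr _ cE) (bigD1 (mate pi t)) /=; last first.
    by rewrite /cross mt mateK lexx.
  by rewrite ltr_wnDr //; apply: sumr_le0.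
apply: negbTE; rewrite -leNgt; apply: sumr_ge0 => x /andP[xt tx].
have tm' : pos t < pos (mate pi t).
  rewrite lt_neqAle tm andbT; apply/eqP => /pos_inj e.
  by have := sg_mate pi t; rewrite -e; case: (t).
suff : ~~ (sg x != sg t) by rewrite negbK => /eqP->; rewrite sgM.
apply/negP => n; apply: (cons x t) => //.
- exact: lt_le_trans tx.
- exact: lt_trans tm'.
rewrite lt_neqAle tx andbT; apply/eqP => /pos_inj e.
by have := lt_trans xt tm'; rewrite e mateK ltxx.
Qed.

(** An edge costs its right end minus its left end, and [closing] tells the two apart without
    reference to [pi]. *)
Lemma mcost_consistent pi : consistent pos pi setT ->
  mcost pi = \sum_t (if closing t then pos t else - pos t).
Proof.
move=> cons; rewrite big_sumType /= [X in _ = _ + X](reindex_perm pi).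
rewrite -big_split; apply: eq_bigr => i _ /=.
rewrite !(closingE _ cons) /= permK.
have [h|h] := ltP (pos (inr (pi i))) (pos (inl i)).
  by rewrite ltNge (ltW h) /= gtr0_norm ?subr_gt0.
rewrite lt_neqAle h andbT ler0_norm ?subr_le0 // opprB.
have [/pos_inj //|_] := eqVneq (pos (inl i)) (pos (inr (pi i))).
by rewrite addrC.
Qed.

Lemma uncross pi : ~~ consistent pos pi setT ->
  exists pi', mcost pi' < mcost pi.
Proof.
(* The white left end [i] and the black left end [j] become partners, and so do their former mates;
   [norm_uncross] compares the two pairs of edges. *)
have H : forall i j, pos (inl i) < pos (inr (pi i)) ->
    pos (inr j) < pos (inl ((pi^-1)%g j)) ->
    pos (inl i) < pos (inl ((pi^-1)%g j)) -> pos (inr j) < pos (inr (pi i)) ->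
    exists pi', mcost pi' < mcost pi.
  move=> i j; set k := (pi^-1)%g j => h1 h2 h3 h4.
  have pk : pi k = j by rewrite permKV.
  have ki : k != i by apply: contraTneq h3 => ->; rewrite ltxx.
  exists (pi * tperm (pi i) j)%g; rewrite /mcost.
  rewrite (bigD1 i) // (bigD1 k) //= [ltRHS](bigD1 i) //.
  rewrite [X in _ < _ + X](bigD1 k) //=.
  rewrite !permM tpermL pk tpermR !addrA [X in _ + X < _](_ : _ =
    \sum_(l | (l != i) && (l != k)) `|pos (inl l) - pos (inr (pi l))|).
    by rewrite ltrD2r; apply: norm_uncross.
  apply: eq_bigr => l /andP[li lk].
  by rewrite permM tpermD // ?(inj_eq perm_inj) 1?eq_sym // -pk (inj_eq perm_inj).
move=> /forall_inPn[x _ /forall_inPn[y _]]; rewrite negb_imply negbK.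
case: x => i; case: y => j //= /and4P[h1 h2 h3 h4].
  exact: (H i j).
exact: (H j i).
Qed.

Lemma minimal_consistent pi :
  [forall pi' : {perm I}, mcost pi <= mcost pi'] = consistent pos pi setT.
Proof.
apply/forallP/idP => [mini|cons pi'].
  apply/negPn/negP => /uncross[pi' lt]; have := mini pi'.
  by rewrite leNgt lt.
(* A minimizer exists by finiteness; being consistent, it costs the same as [pi]. *)
have [pi0 _ min0] := @arg_minP _ _ _ pi xpredT mcost isT.
suff -> : mcost pi = mcost pi0 by apply: min0.
rewrite !mcost_consistent //; apply/negPn/negP => /uncross[pi1].
by rewrite ltNge min0.
Qed.

End Cost.
End Mates.

(** * From half-integer heights to partial sums *)

(** As [e] squares to 1, [h * e] is the integer [S * e] plus one half, so both have the same
    negativity; then [|h|] is [|S|] minus one half. *)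
Lemma half_height (S e : int) : e = 1 \/ e = -1 ->
  let h : rat := S%:~R + e%:~R / 2%:R in
  (h * e%:~R < 0) = (S * e < 0) /\
  (S * e < 0 -> `|h| + 1 / 2%:R = (`|S|%N)%:R).
Proof.
move=> e1 h.
have hE : h * e%:~R = (S * e)%:~R + 2%:R^-1.
  by rewrite /h intrM; case: e1 => ->; field.
split.
  rewrite hE; have [lt|ge] := ltP (S * e) 0.
    have : (S * e)%:~R <= (-1)%:~R :> rat by rewrite ler_int; lia.
    lra.
  have : 0%:~R <= (S * e)%:~R :> rat by rewrite ler_int.
  lra.
move=> lt; have le : (S * e)%:~R <= (-1)%:~R :> rat by rewrite ler_int; lia.
have hn : `|h| = - (h * e%:~R).
  rewrite -ler0_norm ?normrM; last by rewrite hE; lra.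
  by case: e1 => ->; rewrite ?normrN1 ?normr1 mulr1.
have SE : (`|S|%N)%:R = - (S * e)%:~R :> rat.
  by rewrite -mulrNz pmulrn; congr (_%:~R); case: e1 lt => ->; lia.
by rewrite hn hE SE; field.
Qed.

(** * The points of an instance in increasing order *)

Section Points.
Context {R : realFieldType} {N : nat} {L : R} (J : instance N L).

Definition pos (t : 'I_N + 'I_N) : R :=
  match t with inl i => white J i | inr j => black J j end.

Definition all_points : seq ('I_N + 'I_N) :=
  map inl (enum 'I_N) ++ map inr (enum 'I_N).

Definition ranked : seq ('I_N + 'I_N) := sort (relpre pos <=%R) all_points.

Lemma sorted_pointsE : sorted_points J = map pos ranked.
Proof.
rewrite /sorted_points /ranked -sort_map; congr sort.
by rewrite /all_points map_cat; congr (_ ++ _); apply: map_comp.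
Qed.

Lemma mem_ranked t : t \in ranked.
Proof.
rewrite mem_sort mem_cat; case: t => i.
  by rewrite (mem_map inl_inj) mem_enum.
by rewrite (mem_map inr_inj) mem_enum orbT.
Qed.

Lemma size_ranked : size ranked = (2 * N)%N.
Proof.
rewrite size_sort size_cat (size_map inl) (size_map inr) -cardE card_ord.
by rewrite addnn mul2n.
Qed.

Hypothesis hgen : generic J.

Lemma pos_inj : injective pos.
Proof.
have incr_inj (f : 'I_N -> R) :
    (forall i j : 'I_N, (i < j)%N -> f i < f j) -> injective f.
  move=> incr i j e; apply: val_inj.
  by case: (ltngtP i j) => // /incr; rewrite e ltxx.
move: hgen; rewrite /generic /points cat_uniq => /and3P[_ /hasPn disj _].
have neq i j : white J i <> black J j.
  by move=> e; have := disj _ (codom_f (black J) j); rewrite /= -e codom_f.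
case=> i [] j /= e.
- by rewrite (incr_inj _ (white_incr J) _ _ e).
- by case: (neq i j).
- by case: (neq j i).
- by rewrite (incr_inj _ (black_incr J) _ _ e).
Qed.

Lemma ranked_increasing : pairwise (relpre pos <%O) ranked.
Proof.
rewrite -pairwise_map -sorted_pairwise; last exact: lt_trans.
rewrite -sorted_pointsE lt_sorted_uniq_le sort_uniq hgen /=.
exact: (sort_sorted le_total).
Qed.

Lemma nth_ranked_sg (i : 'I_(2 * N)) :
  (map sg ranked)`_i = sign_vector J i.
Proof.
have i_lt : (i < size ranked)%N by rewrite size_ranked.
(* The list is nonempty because [i] indexes it; its head is a default for [nth] that is never
   reached. *)
have x0 : 'I_N + 'I_N by case: ranked i_lt.
rewrite ffunE sorted_pointsE (nth_map x0) // (nth_map x0) //.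
case: (nth x0 ranked i) => k /=; first by rewrite codom_f.
case: codomP => // -[l e].
by have /pos_inj : pos (inr k) = pos (inl l) by [].
Qed.

Lemma num_optimalE : num_optimal J = choices 0 (map sg ranked).
Proof.
(* The reading starts with no open edge: the state 0 comes from an empty [P], and [D] is the set of
   all points. *)
rewrite -[0](mulr0n 1) -(cards0 ('I_N + 'I_N)%type).
have DE : set0 :|: [set x in ranked] = setT.
  by apply/setP => x; rewrite !inE mem_ranked.
rewrite -(@card_completions _ _ _ pos ranked set0 1 1%g) //; first last.
- by move=> t; rewrite DE inE.
- by move=> x y; rewrite inE.
- exact: ranked_increasing.
- by left.
- by move=> x; rewrite inE.
rewrite DE; apply: eq_card => pi; rewrite inE.
rewrite -[X in _ = X]/(pi \in completions pos 1%g setT).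
apply: etrans (minimal_consistent pos_inj pi) _.
apply/idP/completionsP => [c|[]//]; split=> // t.
by rewrite inE.
Qed.

End Points.

Theorem lemma1 (R : realFieldType) (N : nat) (hN : (1 <= N)%N)
    (sigma : {ffun 'I_(2 * N) -> int})
    (hsign : forall i : 'I_(2 * N), sigma i = 1 \/ sigma i = -1)
    (hsum : \sum_(i < 2 * N) sigma i = 0)
    (L : R) (J : instance N L) (hgen : generic J)
    (hJ : sign_vector J = sigma) :
  (num_optimal J)%:R =
    \prod_(i < 2 * N | height sigma i * (sigma i)%:~R < 0) bar_height sigma i
    :> rat.
Proof.
rewrite num_optimalE // choicesE size_map size_ranked natr_prod.
(* Indices failing the height condition get the factor 1, so the two products are compared factor by
   factor. *)
rewrite [RHS]big_mkcond /=; apply: eq_bigr => i _.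
rewrite nth_ranked_sg // hJ add0r.
set S := \sum_(j < i) _.
have hE : height sigma i = S%:~R + (sigma i)%:~R / 2%:R.
  rewrite /height rmorph_sum /=; congr (_ + _).
  pose F j : rat := ((map sg (ranked J))`_j)%:~R.
  rewrite -[RHS]/(\sum_(j < i) F j) (big_ord_widen _ F (ltnW (ltn_ord i))).
  by apply: eq_bigr => j _; rewrite /F nth_ranked_sg // hJ.
have [lt0 bar] := half_height S (hsign i).
rewrite /bar_height hE lt0; case: ifP => // h.
by rewrite bar.
Qed.
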